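(* There are absolute constants $c>0$ and $s_0$ such that for every integer $s\ge s_0$ and every $\varepsilon\in[1/s,1/9]$, for every sufficiently large $n\ge s$, every (possibly adaptive, randomized) $\varepsilon$-tester for convexity of functions $f:[n]\to\mathbb{R}$ having at most $s$ distinct discrete derivatives makes, in the worst case, at least $c\,\frac{\log(\varepsilon s)}{\varepsilon}$ queries.
   Context: For $f:[n]\to\mathbb{R}$, the discrete derivative at $i\in[n-1]$ is $\Delta_f(i)=f(i+1)-f(i)$; the number of distinct discrete derivatives of $f$ is $|\{\Delta_f(i): i\in[n-1]\}|$. $f$ is convex iff $\Delta_f$ is non-decreasing. $f$ is $\varepsilon$-far from convex if every convex $g:[n]\to\mathbb{R}$ differs from $f$ on at least $\varepsilon n$ points. An $\varepsilon$-tester for convexity of a class of functions is a randomized algorithm with oracle (query) access to $f$, whose queries may depend on previous answers, such that for every $f$ in the class it accepts with probability at least $2/3$ if $f$ is convex and rejects with probability at least $2/3$ if $f$ is $\varepsilon$-far from convex. *)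

(* Defs.v *)
From HB Require Import structures.
From mathcomp Require Import all_boot all_order all_algebra.
From mathcomp Require Import all_classical all_reals all_analysis.
From mathcomp Require Import Rstruct Rstruct_topology.
Set Implicit Arguments. Unset Strict Implicit. Unset Printing Implicit Defensive.
Import Order.TTheory GRing.Theory Num.Theory.
Local Open Scope ring_scope.
Local Open Scope classical_set_scope.

Notation RR := Rdefinitions.R.

(* Domain [n] is represented by {0,...,n-1}; a function f : [n] -> R is a
   function nat -> RR of which only the values at i < n matter. *)

Definition dderiv (f : nat -> RR) (i : nat) : RR := f i.+1 - f i.

Definition num_derivs (n : nat) (f : nat -> RR) : nat :=
  size (undup [seq dderiv f i | i <- iota 0 n.-1]).

Definition convex_on (n : nat) (f : nat -> RR) : Prop :=
  forall i : nat, (i.+2 < n)%N -> dderiv f i <= dderiv f i.+1.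

Definition hamming (n : nat) (f g : nat -> RR) : nat :=
  #|[set i : 'I_n | f i != g i]|.

Definition far_from_convex (n : nat) (eps : RR) (f : nat -> RR) : Prop :=
  forall g : nat -> RR, convex_on n g -> eps * n%:R <= (hamming n f g)%:R.

(* A (possibly adaptive, randomized) query algorithm on [n]: given the random
   seed w and the history of answers so far, it chooses the next query point;
   after the queries it decides (true = accept) from the seed and the answers. *)
Record algo (Omega : Type) (n : nat) := Algo {
  alg_query : Omega -> seq RR -> 'I_n;
  alg_decide : Omega -> seq RR -> bool }.

Fixpoint history (n : nat) (qry : seq RR -> 'I_n) (f : nat -> RR) (k : nat)
  : seq RR :=
  match k with
  | 0 => [::]
  | k'.+1 => let h := history qry f k' in rcons h (f (nat_of_ord (qry h)))
  end.

Definition accepts (Omega : Type) (n : nat) (A : algo Omega n) (q : nat)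
  (f : nat -> RR) (w : Omega) : bool :=
  alg_decide A w (history (alg_query A w) f q).

Definition convexity_tester (d : measure_display) (Omega : measurableType d)
  (P : probability Omega RR) (n s : nat) (eps : RR) (A : algo Omega n)
  (q : nat) : Prop :=
  (forall f : nat -> RR, (num_derivs n f <= s)%N ->
      measurable [set w | accepts A q f w]) /\
  (forall f : nat -> RR, (num_derivs n f <= s)%N -> convex_on n f ->
      ((2 / 3 : RR)%:E <= P [set w | accepts A q f w])%E) /\
  (forall f : nat -> RR, (num_derivs n f <= s)%N -> far_from_convex n eps f ->
      ((2 / 3 : RR)%:E <= P [set w | ~~ accepts A q f w])%E).

(* Main.v *)
Require Import Defs.
From HB Require Import structures.
From mathcomp Require Import all_boot all_order all_algebra.
From mathcomp Require Import all_classical all_reals all_analysis.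
From mathcomp Require Import measurable_realfun.
From mathcomp Require Import Rstruct Rstruct_topology.
From mathcomp Require Import zify ring lra.
Import Order.TTheory GRing.Theory Num.Theory.
Local Open Scope ring_scope.

(* By averaging it suffices to exhibit random convex functions and random far
   functions which no deterministic algorithm with few queries tells apart. Put a
   binary tree of depth T over [n], with 2^T leaves of equal length, T being about
   log s, and let f be a sum over the heights k of piecewise affine terms with
   weights B^k, B huge: the slopes of f are then ordered lexicographically, highest
   node first. At each node the left half gets a random integer slope a and the
   right half a + 1, so that f is convex. For a far function choose one of K ~
   1/eps blocks and one of the L = T - log K ~ log (eps s) heights inside a block,
   and give the right halves of the nodes of that height in that block the slope
   a - 1 instead: of four equally spaced points, two in each half of such a node, a
   convex function misses f at one at least, hence on a quarter of the block.
   As long as no node of the chosen height and block has both halves queried, the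
   answers are reproduced by replacing a with a + 2 at some nodes, which is almost
   measure preserving when a ranges over a large interval. Since q queries split the
   nodes of at most q of the K L pairs (block, height), q must be of order K L. *)

(** * Functions on a dyadic tree *)

(** Since [M <= B - 1], the terms below [c] sum to at least [-(B - 1)(1 + ... + B^(c-1)) = 1 - B^c].
    The term at [c] is at least [B^c], which leaves at least 1. *)
Lemma lexicographic_sum_gt0 {H c : nat} {B M : RR} {e : nat -> RR} :
  (c < H)%N -> 0 <= M -> 1 + M <= B ->
  (forall k, (c < k < H)%N -> e k = 0) -> 1 <= e c ->
  (forall k, (k < c)%N -> `|e k| <= M) ->
  0 < \sum_(0 <= k < H) B ^+ k * e k.
Proof.
move=> cH M0 MB ehigh ec elow.
have low m : (m <= c)%N -> 1 - B ^+ m <= \sum_(0 <= k < m) B ^+ k * e k.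
  elim: m => [|m IH] mc; first by rewrite big_nil expr0 subrr.
  rewrite big_nat_recr //= exprSr.
  have Bm : 0 <= B ^+ m by apply: exprn_ge0; lra.
  have : - M <= e m by have := elow m mc; rewrite ler_norml => /andP[].
  have := IH (ltnW mc); nra.
rewrite (@big_cat_nat _ _ _ c.+1) //= [X in _ < _ + X]big_nat_cond.
rewrite [X in _ < _ + X]big1 ?addr0.
  rewrite big_nat_recr //=; have := low c (leqnn c).
  have : 1 <= B ^+ c by apply: exprn_ege1; lra.
  nra.
by move=> k; rewrite andbT => kH; rewrite ehigh ?mulr0.
Qed.

(** Cells of height [k] are named by the quotient [x %/ cell l k], so the halves of the cell [p] of
    height [k+1] are [2p] and [2p+1]. *)
Definition cell (l k : nat) : nat := (2 ^ k * l)%N.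

Lemma cell_gt0 {l : nat} (k : nat) : (0 < l)%N -> (0 < cell l k)%N.
Proof. by move=> l0; rewrite muln_gt0 expn_gt0. Qed.

Lemma cellS (l k : nat) : cell l k.+1 = (2 * cell l k)%N.
Proof. by rewrite /cell expnS mulnA. Qed.

Lemma cellD (l i j : nat) : cell l (i + j) = (2 ^ j * cell l i)%N.
Proof. by rewrite /cell addnC expnD mulnA. Qed.

Lemma leq_cell (l i j : nat) : (i <= j)%N -> (cell l i <= cell l j)%N.
Proof. by move=> ij; rewrite leq_mul2r leq_pexp2l ?orbT. Qed.

Lemma divn_cellD (l i j x : nat) :
  (x %/ cell l (i + j) = x %/ cell l i %/ 2 ^ j)%N.
Proof. by rewrite cellD mulnC divnMA. Qed.

Lemma divn_cellS (l k x : nat) : (x %/ cell l k.+1 = x %/ cell l k %/ 2)%N.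
Proof. by rewrite -addn1 divn_cellD expn1. Qed.

Lemma same_cellW {l i j x y : nat} : (i <= j)%N ->
  (x %/ cell l i = y %/ cell l i)%N -> (x %/ cell l j = y %/ cell l j)%N.
Proof. by move=> ij xy; rewrite -(subnKC ij) !divn_cellD xy. Qed.

(* Twice the signed distance from x + 1/2 to the centre of its cell of height
   k+1; because of the half step it is -1 and 1 at the two middle points of the cell. *)
Definition centered (l k x : nat) : RR :=
  (2 * (x %% cell l k.+1) + 1)%:R - (cell l k.+1)%:R.

Definition tree_term (l : nat) (a : nat -> nat -> RR) (k x : nat) : RR :=
  a k (x %/ cell l k)%N * centered l k x.

(* On a cell p of height k+1 the k-th term is affine on each half, with slopes
   proportional to a k (2p) and a k (2p+1), the two lines meeting at the centre. *)
Definition tree_fun (B : RR) (l H : nat) (a : nat -> nat -> RR) (x : nat) : RR :=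
  \sum_(0 <= k < H) B ^+ k * tree_term l a k x.

Lemma centered_bound {l : nat} (k x : nat) : (0 < l)%N ->
  `|centered l k x| <= (cell l k.+1)%:R.
Proof.
move=> l0; have := ltn_pmod x (cell_gt0 k.+1 l0).
rewrite /centered; move: (cell l k.+1) (x %% _)%N => D r rD.
rewrite ler_norml; apply/andP; split.
  by rewrite lerBrDl subrr ler0n.
by rewrite lerBlDr -natrD ler_nat; lia.
Qed.

Lemma tree_term_bound {A : RR} {l H : nat} {a : nat -> nat -> RR} (k x : nat) :
  (0 < l)%N -> (k < H)%N -> (forall i c, `|a i c| <= A) ->
  `|tree_term l a k x| <= A * (cell l H)%:R.
Proof.
move=> l0 kH aA; rewrite normrM ler_pM //.
by apply: le_trans (centered_bound k x l0) _; rewrite ler_nat leq_cell.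
Qed.

Lemma tree_term_sub {l k x y : nat} (a : nat -> nat -> RR) :
  (x %/ cell l k = y %/ cell l k)%N ->
  tree_term l a k y - tree_term l a k x
    = a k (x %/ cell l k)%N * (2 * (y%:R - x%:R)).
Proof.
move=> xy; rewrite /tree_term -xy -mulrBr; congr (_ * _).
have xy1 : (x %/ cell l k.+1 = y %/ cell l k.+1)%N by rewrite !divn_cellS xy.
have Ex : x%:R = (x %/ cell l k.+1 * cell l k.+1 + x %% cell l k.+1)%:R :> RR.
  by rewrite -divn_eq.
have Ey : y%:R = (y %/ cell l k.+1 * cell l k.+1 + y %% cell l k.+1)%:R :> RR.
  by rewrite -divn_eq.
rewrite Ex Ey /centered xy1 !natrD !natrM; ring.
Qed.

Lemma tree_fun_sub (B : RR) (l H : nat) (a : nat -> nat -> RR) (x y : nat) :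
  tree_fun B l H a y - tree_fun B l H a x
    = \sum_(0 <= k < H) B ^+ k * (tree_term l a k y - tree_term l a k x).
Proof. by rewrite -sumrB; apply: eq_bigr => k _; rewrite mulrBr. Qed.

(** * Slopes and convexity of tree functions *)

Lemma same_cell_succ {l x : nat} (k : nat) : (0 < l)%N -> ~~ (l %| x.+1)%N ->
  (x.+1 %/ cell l k = x %/ cell l k)%N.
Proof.
move=> l0 lx; rewrite divnS ?cell_gt0 //.
suff /negbTE -> : ~~ (cell l k %| x.+1)%N by [].
by apply: contra lx; apply: dvdn_trans; rewrite dvdn_mull.
Qed.

Lemma dderiv_interior {B : RR} {l H x : nat} (a : nat -> nat -> RR) :
  (0 < l)%N -> ~~ (l %| x.+1)%N ->
  dderiv (tree_fun B l H a) x
    = \sum_(0 <= k < H) B ^+ k * (2 * a k (x %/ l %/ 2 ^ k)%N).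
Proof.
move=> l0 lx; rewrite /dderiv tree_fun_sub; apply: eq_bigr => k _.
rewrite tree_term_sub ?same_cell_succ // /cell mulnC divnMA -natr1; ring.
Qed.

(** The critical height [c] is the 2-adic valuation of [(x+1)/l]: an odd multiple of [cell l c] is
    the middle of a cell of height [c+1], and no higher cell begins there. *)
Lemma boundary_height {l H x : nat} : (0 < l)%N -> (x.+1 < cell l H)%N ->
  (l %| x.+1)%N ->
  exists2 c, (c < H)%N & exists2 p, x.+1 = ((2 * p + 1) * cell l c)%N &
    forall k, (c < k)%N -> (x.+1 %/ cell l k = x %/ cell l k)%N.
Proof.
move=> l0 xH /dvdnP[m Em].
have m0 : (0 < m)%N by case: m Em.
pose c := logn 2 m.
have [p Ep] : exists p, m = ((2 * p + 1) * 2 ^ c)%N.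
  have [r r2 Er] := pfactor_coprime (isT : prime 2) m0.
  exists r./2; rewrite Er; congr (_ * _)%N.
  by move: r2; rewrite coprime2n; lia.
have Ex : x.+1 = ((2 * p + 1) * cell l c)%N by rewrite Em Ep /cell mulnA.
exists c.
  rewrite -(@ltn_exp2l 2) // -(ltn_pmul2r l0) -!/(cell _ _).
  by apply: leq_ltn_trans xH; rewrite Ex leq_pmull // addn1.
exists p => // k ck; rewrite divnS ?cell_gt0 // /cell [in X in (X + _)%N]Em dvdn_pmul2r //.
by rewrite pfactor_dvdn // leqNgt ck.
Qed.

(** [centered] passes from -1 to 1, so the step across the middle is the mean of the slopes
    [2 a c (2p)] and [2 a c (2p+1)] of the two halves. *)
Lemma tree_term_boundary {l c x p : nat} (a : nat -> nat -> RR) :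
  (0 < l)%N -> x.+1 = ((2 * p + 1) * cell l c)%N ->
  tree_term l a c x.+1 - tree_term l a c x = a c (2 * p)%N + a c (2 * p + 1)%N.
Proof.
move=> l0; rewrite /tree_term /centered cellS.
have := cell_gt0 c l0; move: (cell l c) => D D0 Ex.
have Ex0 : x = ((2 * p) * D + D.-1)%N by nia.
have E0 : (x %/ D = 2 * p)%N by rewrite Ex0 divnMDl // divn_small ?addn0 //; lia.
have E1 : (x.+1 %/ D = 2 * p + 1)%N by rewrite Ex mulnK.
have E2 : (x %% (2 * D) = D.-1)%N.
  by rewrite Ex0 mulnAC [(2 * D * p)%N]mulnC modnMDl modn_small //; lia.
have E3 : (x.+1 %% (2 * D) = D)%N.
  by rewrite Ex mulnDl mulnAC [(2 * D * p)%N]mulnC modnMDl modn_small //; lia.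
rewrite E0 E1 E2 E3 !natrD.
have -> : (D.-1)%:R = D%:R - 1 :> RR by rewrite -[X in X%:R - _](prednK D0) -natr1 addrK.
ring.
Qed.

(* At a cell boundary the slope inside the term of critical height c (the height
   of the node whose halves meet there) lies strictly between the slopes on both
   sides; the higher terms are affine there and the lower ones are negligible. *)
Lemma tree_fun_convex {B A : RR} {l H n : nat} {a : nat -> nat -> RR} :
  (1 < l)%N -> (n <= cell l H)%N ->
  (forall k c, `|a k c| <= A) -> 1 + 4 * (A * (cell l H)%:R) <= B ->
  (forall k p, a k (2 * p)%N + 1 <= a k (2 * p + 1)%N) ->
  convex_on n (tree_fun B l H a).
Proof.
move=> l1 nH aA AB aS i iN.
have l0 : (0 < l)%N by lia.
have M0 : 0 <= A * (cell l H)%:R by rewrite mulr_ge0 ?(le_trans _ (aA 0%N 0%N)).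
rewrite -subr_ge0 /dderiv !tree_fun_sub -sumrB.
under eq_bigr do rewrite -mulrBr.
set e := fun k : nat => tree_term l a k i.+2 - tree_term l a k i.+1
       - (tree_term l a k i.+1 - tree_term l a k i).
(* A second difference involves four values of the term, counted with multiplicity; hence the factor
   4 in the bound on [B]. *)
have elow k : (k < H)%N -> `|e k| <= 4 * (A * (cell l H)%:R).
  move=> kH; have b x := @tree_term_bound A l H a k x l0 kH aA.
  have := b i; have := b i.+1; have := b i.+2.
  rewrite /e !ler_norml => /andP[? ?] /andP[? ?] /andP[? ?].
  by apply/andP; split; lra.
have e0 k : (i.+1 %/ cell l k = i %/ cell l k)%N ->
    (i.+2 %/ cell l k = i.+1 %/ cell l k)%N -> e k = 0.
  move=> E1 E2; rewrite /e !tree_term_sub //.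
  by rewrite E1 -!natr1; ring.
(* Leaves have at least two points, so at most one of the two consecutive steps crosses a leaf
   boundary. *)
have two : (l %| i.+1)%N -> (l %| i.+2)%N -> False.
  move=> d1 d2; have : (l %| i.+2 - i.+1)%N by rewrite dvdn_sub.
  by rewrite subSnn dvdn1; lia.
have [d1|d1] := boolP (l %| i.+1)%N.
  have d2 : ~~ (l %| i.+2)%N by apply/negP => /(two d1).
  have [|c cH [p Ep up]] := @boundary_height l H i l0 _ d1; first by lia.
  apply/ltW/(lexicographic_sum_gt0 cH _ AB); first by lra.
  - by move=> k /andP[ck kH]; apply: e0; [apply: up | apply: same_cell_succ].
  - rewrite /e (tree_term_boundary _ l0 Ep) tree_term_sub; last by rewrite (same_cell_succ _ l0 d2).
    rewrite Ep mulnK ?cell_gt0 // -Ep -!natr1; have := aS c p; lra.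
  - by move=> k kc; apply: elow; apply: ltn_trans kc cH.
have [d2|d2] := boolP (l %| i.+2)%N.
  have [|c cH [p Ep up]] := @boundary_height l H i.+1 l0 _ d2; first by lia.
  apply/ltW/(lexicographic_sum_gt0 cH _ AB); first by lra.
  - by move=> k /andP[ck kH]; apply: e0; [apply: same_cell_succ | apply: up].
  - rewrite /e (tree_term_boundary _ l0 Ep) tree_term_sub; last by rewrite (same_cell_succ _ l0 d1).
    have -> : (i %/ cell l c = 2 * p)%N.
      rewrite -(same_cell_succ c l0 d1); have := cell_gt0 c l0.
      move: (cell l c) Ep => D Ep D0.
      have -> : i.+1 = (2 * p * D + D.-1)%N by nia.
      by rewrite divnMDl // divn_small ?addn0 //; lia.
    by rewrite -!natr1; have := aS c p; lra.
  - by move=> k kc; apply: elow; apply: ltn_trans kc cH.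
by rewrite big1 // => k _; rewrite -/(e k) e0 ?mulr0 //; apply: same_cell_succ.
Qed.

(** At most [m+1] leaves meet the domain. Each contributes one slope inside (even indices of
    [slope]) and one across its right end (odd indices). *)
Lemma tree_fun_num_derivs {l n m : nat} (B : RR) (H : nat) (a : nat -> nat -> RR) :
  (0 < l)%N -> (n %/ l <= m)%N ->
  (num_derivs n (tree_fun B l H a) <= 2 * m.+1)%N.
Proof.
move=> l0 nm; rewrite /num_derivs.
pose slope c := if odd c then dderiv (tree_fun B l H a) ((c./2.+1 * l).-1)
  else \sum_(0 <= k < H) B ^+ k * (2 * a k (c./2 %/ 2 ^ k)%N).
rewrite -[leqRHS](size_iota 0) -(size_map slope).
apply: uniq_leq_size (undup_uniq _) _ => d; rewrite mem_undup.
move=> /mapP[i]; rewrite mem_iota => /andP[_ iN] ->; apply/mapP.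
have [li|li] := boolP (l %| i.+1)%N; last first.
  exists (i %/ l).*2; last by rewrite /slope odd_double doubleK dderiv_interior.
  have := leq_trans (leq_div2r l (ltnW (leq_trans iN (leq_pred n)))) nm.
  by rewrite mem_iota add0n; move: (i %/ l)%N => c; lia.
have /dvdnP[[|q] Eq] := li; first by [].
exists q.*2.+1; last by rewrite /slope /= odd_double uphalf_double -Eq.
have : (i.+1 %/ l <= m)%N by apply: leq_trans nm; apply: leq_div2r; lia.
by rewrite Eq mulnK // mem_iota add0n; lia.
Qed.

(** * Distance from convexity *)

Lemma convex_on_secant {n : nat} {g : nat -> RR} {x z : nat} (h : nat) :
  convex_on n g -> (x <= z)%N -> (z + h < n)%N ->
  g (x + h)%N - g x <= g (z + h)%N - g z.
Proof.
move=> gC xz; have dmono i j : ((i + j).+1 < n)%N -> dderiv g i <= dderiv g (i + j)%N.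
  elim: j => [|j IH]; rewrite ?addn0 // addnS => ijn.
  by apply: le_trans (IH (ltnW ijn)) (gC _ ijn).
elim: h => [|h IH] zh; first by rewrite !addn0 !subrr.
rewrite !addnS in zh *; have := IH (ltnW zh).
have := dmono (x + h)%N (z - x)%N.
have -> : (x + h + (z - x) = z + h)%N by lia.
by rewrite /dderiv => /(_ zh); lra.
Qed.

(** Leaves have even length [2 * r] so that each half of a node, even at height [j = 0], consists of
    two quarters of [h] points. Each reversed node then carries [h] disjoint quadruples of points at
    spacing [h], and [g] misses [f] in every one. *)
Lemma tree_fun_hamming {B A : RR} {r H n j u v : nat} {a : nat -> nat -> RR}
    (h := (2 ^ j * r)%N) {g : nat -> RR} :
  (0 < r)%N -> (j < H)%N -> (v * (4 * h) <= n)%N ->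
  (forall k c, `|a k c| <= A) -> 1 + 4 * (A * (cell (2 * r) H)%:R) <= B ->
  (forall p, (u <= p < v)%N -> a j (2 * p + 1)%N + 1 <= a j (2 * p)%N) ->
  convex_on n g ->
  ((v - u) * h <= hamming n (tree_fun B (2 * r) H a) g)%N.
Proof.
move=> r0 jH vn aA AB aS gC; set f := tree_fun _ _ _ _.
have h0 : (0 < h)%N by rewrite muln_gt0 expn_gt0.
have l0 : (0 < 2 * r)%N by rewrite muln_gt0.
have Ej : cell (2 * r) j = (2 * h)%N by rewrite /cell mulnCA.
clearbody h; have M0 : 0 <= A * (cell (2 * r) H)%:R.
  by rewrite mulr_ge0 ?(le_trans _ (aA 0%N 0%N)).
have conc p t : (u <= p < v)%N -> (t < h)%N -> forall x, x = (p * (4 * h) + t)%N ->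
    f (x + 3 * h)%N - f (x + 2 * h)%N < f (x + h)%N - f x.
  move=> upv th x Ex; rewrite -subr_gt0 !tree_fun_sub -sumrB.
  under eq_bigr do rewrite -mulrBr.
  have Exj i : (i < 4)%N ->
      ((x + i * h) %/ cell (2 * r) j = 2 * p + i %/ 2)%N.
    move=> i4; rewrite Ej.
    have -> : (x + i * h = (2 * p + i %/ 2) * (2 * h) + (i %% 2 * h + t))%N.
      rewrite Ex {1}(divn_eq i 2); ring.
    rewrite divnMDl ?muln_gt0 ?h0 // [((_ + t) %/ _)%N]divn_small ?addn0 //.
    have := ltn_pmod i (isT : 0 < 2)%N; nia.
  have Exk i k : (j < k)%N -> (i < 4)%N ->
      ((x + i * h) %/ cell (2 * r) k = x %/ cell (2 * r) k)%N.
    move=> jk i4; apply: same_cellW jk _.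
    have := Exj 0%N isT; rewrite mul0n addn0 !divn_cellS => ->; rewrite Exj //; lia.
  apply: (lexicographic_sum_gt0 jH _ AB); first by lra.
  (* Above height [j] the four points share a cell, where the increments over two steps of equal
     length cancel. *)
  - move=> k /andP[jk kH].
    have E0 := Exk 1%N k jk isT; have E2 := Exk 2%N k jk isT.
    have E3 := Exk 3%N k jk isT; rewrite mul1n in E0.
    rewrite !tree_term_sub ?E0 ?E2 ?E3 // !natrD; ring.
  - have E0 := Exj 0%N isT; have E1 := Exj 1%N isT.
    have E2 := Exj 2%N isT; have E3 := Exj 3%N isT.
    rewrite mul1n in E1; rewrite mul0n addn0 in E0.
    rewrite !tree_term_sub ?E0 ?E1 ?E2 ?E3 // addn0.
    have := aS p upv; have : 1 <= h%:R :> RR by rewrite ler1n.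
    rewrite !natrD; nra.
  - move=> k kj; have b y := @tree_term_bound A _ H a k y l0 (ltn_trans kj jH) aA.
    have := b x; have := b (x + h)%N.
    have := b (x + 2 * h)%N; have := b (x + 3 * h)%N; rewrite !ler_norml.
    move=> /andP[? ?] /andP[? ?] /andP[? ?] /andP[? ?]; apply/andP; split; lra.
rewrite /hamming cardE -[leqLHS](size_iota (u * h)).
(* [phi] numbers the quadruple of a point. It suffices that every number in [[u*h, v*h)] is attained
   at a point where [f] and [g] differ. *)
pose phi (x : 'I_n) := (x %/ (4 * h) * h + x %% h)%N.
rewrite -(size_map phi); apply: uniq_leq_size (iota_uniq _ _) _ => y.
rewrite mem_iota => /andP[uy yv].
have upv : (u <= y %/ h < v)%N by rewrite leq_divRL // ltn_divLR //; lia.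
have th := ltn_pmod y h0.
pose x := (y %/ h * (4 * h) + y %% h)%N.
have [i i4 fg] : exists2 i, (i < 4)%N & f (x + i * h)%N != g (x + i * h)%N.
  have fx := conc _ _ upv th x erefl.
  apply: contrapT => all_eq.
  have fg i : (i < 4)%N -> f (x + i * h)%N = g (x + i * h)%N.
    by move=> i4; apply/eqP/negPn/negP => ne; apply: all_eq; exists i.
  have := @convex_on_secant n g x (x + 2 * h) h gC (leq_addr _ _).
  have -> : (x + 2 * h + h = x + 3 * h)%N by lia.
  have := fg 0%N isT; have := fg 1%N isT; rewrite mul0n addn0 mul1n.
  move=> <- <-; rewrite -!fg // leNgt fx => sec.
  suff /sec : (x + 3 * h < n)%N by [].
  rewrite /x; nia.
have xn : (x + i * h < n)%N by rewrite /x; nia.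
apply/mapP; exists (Ordinal xn); first by rewrite mem_enum inE.
have -> : phi (Ordinal xn) = (y %/ h * h + y %% h)%N; last exact: divn_eq.
rewrite /phi /=; congr (_ * _ + _)%N.
  rewrite /x -addnA divnMDl ?muln_gt0 ?h0 // [((_ + _) %/ _)%N]divn_small ?addn0 //.
  by have := leq_mul i4 (leqnn h); rewrite mulSn; lia.
have -> : (x + i * h = (y %/ h * 4 + i) * h + y %% h)%N by rewrite /x; ring.
by rewrite modnMDl modn_mod.
Qed.

(** * Nodes split by the queries *)

(** Blocks are the cells of height [L]. Reversing the pair [(b, j)] can be noticed only by querying
    both halves of one of its nodes. *)
Definition splits (l L : nat) (Q : seq nat) (b j : nat) : bool :=
  has (fun x => has (fun y => [&& x %/ cell l L == b,
    x %/ cell l j.+1 == y %/ cell l j.+1 & x %/ cell l j != y %/ cell l j]%N) Q) Q.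

Lemma splitsP {l L b j : nat} {Q : seq nat} :
  reflect (exists x y, [/\ x \in Q, y \in Q & [/\ x %/ cell l L = b,
    x %/ cell l j.+1 = y %/ cell l j.+1 & x %/ cell l j <> y %/ cell l j]%N])
    (splits l L Q b j).
Proof.
apply: (iffP hasP) => [[x Qx /hasP[y Qy /and3P[/eqP bx /eqP E /eqP N]]]|].
  by exists x, y.
move=> [x [y [Qx Qy [bx E N]]]]; exists x => //; apply/hasP; exists y => //.
by apply/and3P; split; apply/eqP.
Qed.

(* A new point x creates at most one split: if it is separated from y at height j
   and from y' at a larger height j', then y and y' are already separated at j'. *)
Lemma card_splits (l K L : nat) (Q : seq nat) :
  (#|[set bj : 'I_K * 'I_L | splits l L Q bj.1 bj.2]%SET| <= size Q)%N.
Proof.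
elim: Q => [|x Q IH]; first by rewrite leqn0 cards_eq0; apply/eqP/setP => ?; rewrite !inE.
set S := [set _ | _]%SET in IH; set S' := [set _ | _]%SET.
rewrite -(cardsID S S') /= -add1n addnC leq_add //.
  apply/card_le1_eqP => -[b j] [b' j']; rewrite !inE /=.
  move=> /andP[ns /splitsP sp] /andP[ns' /splitsP sp'].
  (* A new split must involve [x], and by symmetry [x] may be taken as its first point. *)
  have red (b0 : 'I_K) (j0 : 'I_L) : ~~ splits l L Q b0 j0 ->
      (exists x0 y0, [/\ x0 \in x :: Q, y0 \in x :: Q &
        [/\ x0 %/ cell l L = b0, x0 %/ cell l j0.+1 = y0 %/ cell l j0.+1
          & x0 %/ cell l j0 <> y0 %/ cell l j0]%N]) ->
      (x %/ cell l L)%N = b0 /\ exists2 y, y \in Q &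
        (x %/ cell l j0.+1)%N = (y %/ cell l j0.+1)%N /\
        (x %/ cell l j0)%N <> (y %/ cell l j0)%N.
    move=> nsp [x0 [y0 [+ + [bx E N]]]]; rewrite !inE.
    have E' := same_cellW (ltn_ord j0) E.
    move=> /orP[/eqP xx|Qx] /orP[/eqP yy|Qy].
    - by rewrite xx yy in N.
    - by rewrite -xx; split=> //; exists y0.
    - by rewrite -yy -E'; split=> //; exists x0 => //; split=> // F; apply: N.
    - by case/negP: nsp; apply/splitsP; exists x0, y0.
  have [bx [y Qy [Ey Ny]]] := red _ _ ns sp.
  have [bx' [y' Qy' [Ey' Ny']]] := red _ _ ns' sp'.
  have Eb : b = b' by apply: ord_inj; rewrite -bx -bx'.
  have lt (i i' : 'I_L) z z' : ~~ splits l L Q b i' -> z \in Q -> z' \in Q ->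
      (x %/ cell l i.+1)%N = (z %/ cell l i.+1)%N ->
      (x %/ cell l i'.+1)%N = (z' %/ cell l i'.+1)%N ->
      (x %/ cell l i')%N <> (z' %/ cell l i')%N -> ~ (i < i')%N.
    move=> nsp Qz Qz' Ez Ez' Nz' ii'; case/negP: nsp; apply/splitsP.
    have Exz := same_cellW ii' Ez; exists z, z'; split=> //.
    split; rewrite -?Exz //; last by rewrite -Ez' (same_cellW (leqnSn i') Exz).
    by rewrite -bx (same_cellW (ltn_ord i) Ez).
  have /negP h1 := lt j' j y' y ns Qy' Qy Ey' Ey Ny.
  rewrite -Eb in ns'; have /negP h2 := lt j j' y y' ns' Qy Qy' Ey Ey' Ny'.
  have Ej : j = j' by apply: ord_inj; lia.
  by rewrite Eb Ej.
by apply: leq_trans (subset_leq_card (subsetIr _ _)) IH.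
Qed.

(** * Random labels and the coupling of the two families *)

Definition queries {n : nat} (qry : seq RR -> 'I_n) (f : nat -> RR) (q : nat)
  : seq nat := [seq nat_of_ord (qry (history qry f k)) | k <- iota 0 q].

(** Agreement is needed only along the run on [f]: by induction the run on [g] receives the same
    answers and asks the same points. *)
Lemma history_agree {n q : nat} {qry : seq RR -> 'I_n} {f g : nat -> RR} :
  {in queries qry f q, f =1 g} ->
  forall k, (k <= q)%N -> history qry f k = history qry g k.
Proof.
move=> fg; elim=> [//|k IH] kq /=; rewrite -IH ?(ltnW kq) // fg //.
by apply/mapP; exists k => //; rewrite mem_iota.
Qed.

Lemma queries_agree {n q : nat} {qry : seq RR -> 'I_n} {f g : nat -> RR} :
  {in queries qry f q, f =1 g} -> queries qry f q = queries qry g q.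
Proof.
move=> fg; apply/eq_in_map => k; rewrite mem_iota => /= kq.
by rewrite (history_agree fg) // ltnW.
Qed.

(** A finite type, so that uniform random labels become counting. Its rectangular index set contains
    every node that meets the domain; [inord] sends other indices to 0, so bounds on labels hold at
    all indices. *)
Definition labelling (T n R : nat) := {ffun 'I_T.+1 * 'I_n.+1 -> 'I_R}.

Definition label {T n R : nat} (a : labelling T n R) (k p : nat) : nat :=
  a (inord k, inord p).

Definition yes_slope {T n R : nat} (a : labelling T n R) (k c : nat) : RR :=
  (label a k (c %/ 2))%:R + (c %% 2)%:R.

Definition no_slope {T n R : nat} (L b j : nat) (a : labelling T n R) (k c : nat)
  : RR :=
  (label a k (c %/ 2))%:R +
  if (k == j) && (c %/ 2 ^ (L - j) == b)%N then - (c %% 2)%:R else (c %% 2)%:R.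

(* Raises by 2 the labels of the reversed nodes of which Q meets the right half,
   so that the slope a + 1 there is reproduced as (a + 2) - 1. *)
Definition shift_labels {T n R : nat} (l L b j : nat) (Q : seq nat)
    (a : labelling T n R) : labelling T n R.+2 :=
  [ffun v => inord (a v + 2 * [&& v.1 == j :> nat, v.2 %/ 2 ^ (L - j.+1) == b &
                               has (fun x => x %/ cell l j == 2 * v.2 + 1) Q])%N].

Lemma shift_labelsE {T n R l L b j : nat} {Q : seq nat} (a : labelling T n R) v :
  (shift_labels l L b j Q a v = a v + 2 * [&& v.1 == j :> nat,
     v.2 %/ 2 ^ (L - j.+1) == b &
     has (fun x => x %/ cell l j == 2 * v.2 + 1) Q] :> nat)%N.
Proof.
rewrite ffunE inordK //; have := ltn_ord (a v).
by case: ([&& _, _ & _]) => /=; lia.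
Qed.

Lemma shift_labels_inj {T n R : nat} (l L b j : nat) (Q : seq nat) :
  injective (@shift_labels T n R l L b j Q).
Proof.
move=> a a' /ffunP aa'; apply/ffunP => v; apply: val_inj.
by have := congr1 val (aa' v); rewrite /= !shift_labelsE => /addIn.
Qed.

(** A queried left half needs an unshifted label. Without a split this holds, as a shift would mean
    that [Q] meets the right half too. *)
Lemma yes_no_agree {T n R l L b j : nat} {Q : seq nat} (B : RR)
    (a : labelling T n R) :
  (0 < l)%N -> (j < L)%N -> {in Q, forall x, (x < n)%N} ->
  ~~ splits l L Q b j ->
  {in Q, tree_fun B l T.+1 (yes_slope a)
      =1 tree_fun B l T.+1 (no_slope L b j (shift_labels l L b j Q a))}.
Proof.
move=> l0 jL Qn nsp x Qx; apply: eq_big_nat => k /andP[_ kT].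
congr (_ * _); rewrite /tree_term /yes_slope /no_slope /label; congr (_ * _).
have D0 := cell_gt0 k l0; set c := (x %/ cell l k)%N.
have cn : (c %/ 2 < n.+1)%N.
  rewrite ltnS; apply: leq_trans (leq_div _ _) _.
  by apply: leq_trans (leq_div _ _) (ltnW (Qn x Qx)).
rewrite shift_labelsE /= !inordK //.
case: eqVneq => [kj|_] /=; last by rewrite muln0 addn0.
have Ec : (c %/ 2 ^ (L - j) = x %/ cell l L)%N.
  by rewrite /c kj -{2}(subnKC (ltnW jL)) divn_cellD.
have -> : (c %/ 2 %/ 2 ^ (L - j.+1) = x %/ cell l L)%N.
  by rewrite -divnMA -expnS subnSK.
rewrite Ec; case: eqVneq => [xb|_] /=; last by rewrite muln0 addn0.
have [c1|c0] : (c %% 2 = 1 \/ c %% 2 = 0)%N by lia.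
  have -> : has (fun x => x %/ cell l j == 2 * (c %/ 2) + 1)%N Q.
    apply/hasP; exists x => //; rewrite -kj -/c; apply/eqP; lia.
  rewrite /= muln1 c1 natrD; ring.
have /negbTE -> : ~~ has (fun x => x %/ cell l j == 2 * (c %/ 2) + 1)%N Q.
  apply: contra nsp => /hasP[y Qy /eqP Ey]; apply/splitsP; exists x, y; split=> //.
  rewrite !divn_cellS Ey -kj -/c; split=> //.
    by rewrite [(2 * _)%N]mulnC divnMDl // addn0.
  by have := divn_eq c 2; move: (c %/ 2)%N c0 => d -> E F; move: E; rewrite {1}F; lia.
by rewrite c0 muln0 addn0 oppr0.
Qed.

(** The seed is fixed, so the algorithm is deterministic. For each pair, the accepted labellings
    without a split inject into accepted far instances; each labelling is lost for at most [q]
    pairs. *)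
Lemma accepting_labellings {Omega : Type} {n : nat} {A : algo Omega n}
    {w : Omega} {T R l K L q : nat} (B : RR) :
  (0 < l)%N ->
  (K * L * \sum_(a : labelling T n R)
             accepts A q (tree_fun B l T.+1 (yes_slope a)) w
   <= q * #|{: labelling T n R}| +
      \sum_(bj : 'I_K * 'I_L) \sum_(a : labelling T n R.+2)
        accepts A q (tree_fun B l T.+1 (no_slope L bj.1 bj.2 a)) w)%N.
Proof.
move=> l0; pose fy (a : labelling T n R) := tree_fun B l T.+1 (yes_slope a).
pose fn (bj : 'I_K * 'I_L) (a : labelling T n R.+2) :=
  tree_fun B l T.+1 (no_slope L bj.1 bj.2 a).
pose Q a := queries (alg_query A w) (fy a) q.
pose sp bj a := splits l L (Q a) (bj.1 : 'I_K) (bj.2 : 'I_L).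
have coupled bj : (\sum_a (accepts A q (fy a) w && ~~ sp bj a)
    <= \sum_a accepts A q (fn bj a) w)%N.
  pose phi a := shift_labels l L bj.1 bj.2 (Q a) a.
  have agree a : ~~ sp bj a -> {in Q a, fy a =1 fn bj (phi a)}.
    move=> nsp; apply: yes_no_agree => //.
    by move=> x /mapP[k _ ->]; apply: ltn_ord.
  pose S := [set a | accepts A q (fy a) w && ~~ sp bj a]%SET.
  (* The shift depends on the queries made, but labellings with the same image have the same
     queries, namely those of the run on the common far function. *)
  have phi_inj : {in S &, injective phi}.
    move=> a a'; rewrite !inE => /andP[_ na] /andP[_ na'] E.
    move: (E); rewrite /phi /Q (queries_agree (agree _ na)) E.
    by rewrite (queries_agree (agree _ na')) => /shift_labels_inj.
  rewrite -big_mkcond sum1dep_card -/S -(card_in_imset phi_inj).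
  rewrite -big_mkcond sum1dep_card; apply: subset_leq_card.
  apply/fintype.subsetP => _ /imsetP[a + ->]; rewrite !inE => /andP[acc na].
  by move: acc; rewrite /accepts (history_agree (agree _ na)).
have few_splits a : (\sum_bj sp bj a <= q)%N.
  rewrite -big_mkcond sum1dep_card.
  by apply: leq_trans (card_splits _ _ _ _) _; rewrite size_map size_iota.
have -> : (K * L = #|{: 'I_K * 'I_L}|)%N by rewrite card_prod !card_ord.
rewrite -sum_nat_const.
apply: (@leq_trans (\sum_(bj : 'I_K * 'I_L) \sum_a sp bj a +
  \sum_(bj : 'I_K * 'I_L) \sum_a (accepts A q (fy a) w && ~~ sp bj a))).
  rewrite -big_split leq_sum // => bj _; rewrite -big_split leq_sum // => a _.
  by case: (accepts _ _ _ _) (sp bj a) => [] [].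
apply: leq_add; last by apply: leq_sum.
rewrite exchange_big mulnC -sum_nat_const; exact: leq_sum.
Qed.

(** * Averaging over the seed *)

Lemma probability_double_count {d : measure_display} {Omega : measurableType d}
    {R : realType} {P : probability Omega R} {I J : finType} {m c : nat}
    {a : I -> Omega -> bool} {b : J -> Omega -> bool} :
  (forall i, measurable [set w | a i w]%classic) ->
  (forall j, measurable [set w | b j w]%classic) ->
  (forall i, (2 / 3 : R)%:E <= P [set w | a i w]%classic)%E ->
  (forall j, (2 / 3 : R)%:E <= P [set w | ~~ b j w]%classic)%E ->
  (forall w, (m * \sum_i a i w <= c + \sum_j b j w)%N) ->
  (m * #|I|)%:R * (2 / 3) <= c%:R + #|J|%:R * (1 / 3) :> R.
Proof.
move=> ma mb Pa Pb ab.
pose F w : \bar R := (\sum_(i : I) (m%:R * \1_[set w | a i w] w)%:E)%E.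
pose G w : \bar R := (c%:R%:E + \sum_(j : J) (\1_[set w | b j w] w)%:E)%E.
have ind1 (S : set Omega) : measurable S -> 
      measurable_fun setT (fun w : Omega => ((\1_S w : R)%:E)).
  by move=> mS; apply/measurable_EFinP; apply: measurable_indic.
have FG : (\int[P]_w F w <= \int[P]_w G w)%E.
  apply: ge0_le_integral => //.
  - by move=> w _; apply: sume_ge0 => i _; rewrite lee_fin mulr_ge0.
  - apply: emeasurable_sum => i; apply/measurable_EFinP.
    by apply: measurable_funM => //; apply: measurable_indic.
  - apply: emeasurable_funD => //; apply: emeasurable_sum => j.
    exact: ind1.
  - move=> w _; rewrite /F /G !sumEFin lee_fin -mulr_sumr.
    under eq_bigr do rewrite indicE mem_setE.
    under [in leRHS]eq_bigr do rewrite indicE mem_setE.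
    by rewrite -!natr_sum -natrM -natrD ler_nat; apply: ab.
have IF : (\int[P]_w F w = \sum_(i : I) m%:R%:E * P [set w | a i w]%classic)%E.
  rewrite ge0_integral_sum //; last first.
    move=> i; apply/measurable_EFinP.
    by apply: measurable_funM => //; apply: measurable_indic.
  apply: eq_bigr => i _; under eq_integral do rewrite EFinM.
  rewrite ge0_integralZl //; last exact: ind1.
  by rewrite integral_indic // setIT.
have IG : (\int[P]_w G w = c%:R%:E + \sum_(j : J) P [set w | b j w]%classic)%E.
  rewrite ge0_integralD //; last 2 first.
  - by move=> w _; apply: sume_ge0.
  - by apply: emeasurable_sum => j; apply: ind1.
  rewrite integral_cst //; congr (_ + _)%E.
    by rewrite -[RHS]mule1; congr (_ * _)%E; apply: probability_setT.
  rewrite ge0_integral_sum //; last by move=> j; apply: ind1.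
  by apply: eq_bigr => j _; rewrite integral_indic // setIT.
have PJ j : (P [set w | b j w]%classic <= (1 / 3 : R)%:E)%E.
  have : [set w | ~~ b j w]%classic = (~` [set w | b j w])%classic.
    by apply/seteqP; split => w /= /negP.
  have := Pb j => /[swap] ->; rewrite probability_setC //.
  have := probability_le1 P (mb j).
  case: (P _) => [r| |] //= _; last by rewrite leNye.
  by rewrite -EFinD !lee_fin; lra.
rewrite -lee_fin; apply: (@le_trans _ _ (\int[P]_w F w)%E).
  rewrite IF; apply: (@le_trans _ _ (\sum_(i : I) (m%:R * (2 / 3) : R)%:E)%E).
    by rewrite sumEFin sumr_const natrM lee_fin -[_ *+ #|I|]mulr_natr; lra.
  by apply: lee_sum => i _; rewrite EFinM; apply: lee_pmul.
apply: (le_trans FG); rewrite IG EFinD; apply: leeD => //.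
apply: (@le_trans _ _ (\sum_(j : J) (1 / 3 : R)%:E)%E); first exact: lee_sum.
by rewrite sumEFin sumr_const lee_fin mulr_natl.
Qed.

(** * The query bound and the choice of parameters *)

Lemma label_bound {T n R : nat} (a : labelling T n R) (k p : nat) :
  (label a k p)%:R + 1 <= R%:R :> RR.
Proof. by rewrite natr1 ler_nat; apply: ltn_ord. Qed.

Lemma yes_slope_bound {T n R : nat} (a : labelling T n R) (k c : nat) :
  `|yes_slope a k c| <= R%:R.
Proof.
rewrite /yes_slope ger0_norm; last by rewrite addr_ge0.
apply: le_trans (label_bound a k (c %/ 2)); rewrite lerD2l lern1.
by lia.
Qed.

Lemma no_slope_bound {T n R : nat} (L b j : nat) (a : labelling T n R)
    (k c : nat) : `|no_slope L b j a k c| <= R%:R.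
Proof.
have := label_bound a k (c %/ 2); rewrite /no_slope ler_norml.
have : (c %% 2)%:R <= 1 :> RR by rewrite lern1; lia.
have := ler0n RR (c %% 2); have := ler0n RR (label a k (c %/ 2)).
by case: ifP => _ *; apply/andP; split; lra.
Qed.

Lemma half_children (p : nat) : [/\ (2 * p) %/ 2 = p, (2 * p + 1) %/ 2 = p,
  (2 * p) %% 2 = 0 & (2 * p + 1) %% 2 = 1]%N.
Proof. by split; lia. Qed.

Lemma yes_slope_increasing {T n R : nat} (a : labelling T n R) (k p : nat) :
  yes_slope a k (2 * p) + 1 <= yes_slope a k (2 * p + 1).
Proof.
by rewrite /yes_slope; have [-> -> -> ->] := half_children p; rewrite addr0.
Qed.

Lemma no_slope_decreasing {T n R L b j p : nat} (a : labelling T n R) :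
  (j < L)%N -> (p %/ 2 ^ (L - j.+1) = b)%N ->
  no_slope L b j a j (2 * p + 1) + 1 <= no_slope L b j a j (2 * p).
Proof.
move=> jL pb; rewrite /no_slope eqxx -subnSK // expnS !divnMA.
have [-> -> -> ->] := half_children p.
by rewrite pb eqxx /= oppr0 addr0 addrNK.
Qed.

(** Shifted labels range over [R+2] values instead of [R]; with [V] labels and [R+2 = 10V] this
    enlarges the family by a factor of at most 5/4. *)
Lemma label_range_loss (V R : nat) : (R.+2 = 10 * V)%N ->
  4 * (R.+2)%:R ^+ V <= 5 * R%:R ^+ V :> RR.
Proof.
move=> RV; have ER : R%:R = (R.+2)%:R - 2 :> RR by rewrite -addn2 natrD addrK.
have R0 : 0 <= R%:R :> RR by [].
rewrite ER in R0 *; set x : RR := (R.+2)%:R in R0 *.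
have Ex : x = 10 * V%:R by rewrite /x RV natrM.
(* Bernoulli's inequality [1 - 2k/x <= (1 - 2/x)^k] with denominators cleared. *)
have step k : x ^+ k * (x - 2 * k%:R) <= x * (x - 2) ^+ k.
  elim: k => [|k IH]; first by rewrite !expr0 mulr0 subr0 mul1r mulr1.
  rewrite !exprSr -[k.+1%:R]natr1 mulrA.
  apply: le_trans (ler_wpM2r R0 IH); rewrite -!mulrA ler_wpM2l ?exprn_ge0 //.
  have := ler0n RR k; nra.
have x0 : 0 < x by lra.
have := step V; have -> : x - 2 * V%:R = x * (4 / 5) by lra.
by rewrite mulrCA ler_pM2l // => ?; lra.
Qed.

(** The first [2^T] leaves, grouped into [2^J] blocks, fill the domain up to less than one leaf,
    because [2^T <= r]. One more level of the tree covers this remainder. *)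
Lemma convexity_tester_queries {d : measure_display} {Omega : measurableType d}
    {P : probability Omega RR} {n s : nat} {eps : RR} {A : algo Omega n}
    {q : nat} (J L r : nat) (T := (J + L)%N) :
  (2 ^ T <= r)%N -> (2 ^ T.+1 * r <= n < 2 ^ T.+1 * r.+1)%N ->
  (2 * (2 ^ T).+1 <= s)%N -> 0 <= eps -> eps * (2 ^ J)%:R <= 1 / 8 ->
  convexity_tester P s eps A q -> (2 ^ J * L)%:R / 4 <= q%:R :> RR.
Proof.
move=> Tr /andP[rn nr] Ts eps0 epsJ [mA [yesA noA]].
have r0 : (0 < r)%N by apply: leq_trans Tr; rewrite expn_gt0.
have l0 : (0 < 2 * r)%N by rewrite muln_gt0.
pose V := #|{: 'I_T.+1 * 'I_n.+1}|.
have V0 : (0 < V)%N by apply/card_gt0P; exists (ord0, ord0).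
pose R := (10 * V - 2)%N.
have RV : (R.+2 = 10 * V)%N by rewrite /R; lia.
pose D : RR := (cell (2 * r) T.+1)%:R.
(* One [B] serves both families, hence the larger label range [R+2]. *)
pose B : RR := 1 + 4 * ((R.+2)%:R * D).
have nH : (n <= cell (2 * r) T.+1)%N.
  by apply: leq_trans (ltnW nr) _; rewrite leq_mul2l; lia.
have nl : (n %/ (2 * r) <= 2 ^ T)%N.
  rewrite -ltnS ltn_divLR //; apply: leq_trans nr _.
  by rewrite expnS; nia.
pose Y (a : labelling T n R) := tree_fun B (2 * r) T.+1 (yes_slope a).
pose N (p : ('I_(2 ^ J) * 'I_L) * labelling T n R.+2) :=
  tree_fun B (2 * r) T.+1 (no_slope L p.1.1 p.1.2 p.2).
have Ys a : (num_derivs n (Y a) <= s)%N.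
  by apply: leq_trans Ts; apply: tree_fun_num_derivs.
have Ns p : (num_derivs n (N p) <= s)%N.
  by apply: leq_trans Ts; apply: tree_fun_num_derivs.
have Yc a : convex_on n (Y a).
  apply: (@tree_fun_convex _ (R.+2)%:R) => //; first by lia.
    move=> k c; apply: le_trans (yes_slope_bound _ _ _) _.
    by rewrite ler_nat; lia.
  exact: yes_slope_increasing.
have Nf p : far_from_convex n eps (N p).
  move: p => [[b j] a] g gC.
  have jL := ltn_ord j; have bJ := ltn_ord b.
  have EL : (2 ^ L = 2 * (2 ^ (L - j.+1) * 2 ^ j))%N.
    by rewrite -expnD -expnS; congr (_ ^ _)%N; lia.
  have ET : (2 ^ T.+1 = 2 ^ J * (2 * 2 ^ L))%N by rewrite expnS expnD mulnCA.
  have w0 : (0 < 2 ^ (L - j.+1))%N by rewrite expn_gt0.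
  have := @tree_fun_hamming B (R.+2)%:R r T.+1 n j (b * 2 ^ (L - j.+1))
    (b.+1 * 2 ^ (L - j.+1)) (no_slope L b j a) g r0.
  rewrite /= -mulnBl subSnn mul1n => ham.
  apply: (@le_trans _ _ (2 ^ (L - j.+1) * (2 ^ j * r))%:R); last first.
    rewrite ler_nat; apply: ham => //.
    - by rewrite /T; lia.
    - apply: leq_trans rn; rewrite ET EL.
      have : (b.+1 * (2 ^ (L - j.+1) * 2 ^ j * r) <= 2 ^ J * (2 ^ (L - j.+1) * 2 ^ j * r))%N.
        by rewrite leq_mul2r bJ orbT.
      by lia.
    - exact: no_slope_bound.
    - move=> p /andP[p1 p2]; apply: no_slope_decreasing => //.
      by apply/eqP; rewrite eqn_leq leq_divRL // p1 -ltnS ltn_divLR // p2.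
  (* The 8 is 4, for the quarter of a block, times 2, for the remainder of [n]. *)
  have nr' : n%:R <= (2 ^ J)%:R * (2 ^ (L - j.+1) * 2 ^ j)%:R * (8 * r%:R) :> RR.
    rewrite -[8]/(8%:R) -!natrM ler_nat; apply: leq_trans (ltnW nr) _.
    rewrite ET EL; nia.
  rewrite mulnA natrM; apply: le_trans (ler_wpM2l eps0 nr') _.
  have : 0 <= (2 ^ (L - j.+1) * 2 ^ j)%:R * (8 * r%:R) :> RR by rewrite !mulr_ge0.
  nra.
have count w : ((2 ^ J * L) * \sum_a accepts A q (Y a) w
    <= q * #|{: labelling T n R}| + \sum_p accepts A q (N p) w)%N.
  have := @accepting_labellings _ _ A w T R _ (2 ^ J) L q B l0.
  by rewrite pair_bigA.
have := probability_double_count (fun a => mA (Y a) (Ys a))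
  (fun p => mA (N p) (Ns p)) (fun a => yesA (Y a) (Ys a) (Yc a))
  (fun p => noA (N p) (Ns p) (Nf p)) count.
rewrite (card_prod _ (labelling _ _ _)) !card_ffun !card_ord -/V.
rewrite card_prod !card_ord.
have := label_range_loss V R RV; rewrite !natrM !natrX.
have : 0 < R%:R ^+ V :> RR by rewrite exprn_gt0 // ltr0n; lia.
have : 0 <= (2 ^ J)%:R * L%:R :> RR by rewrite mulr_ge0.
rewrite natrX.
set X := R%:R ^+ V; set Z := (R.+2)%:R ^+ V; set M := _ * _ => M0 X0 ZX H.
(* From [Z <= 5/4 X] the gap left is [2/3 - 1/3 * 5/4 = 1/4]. *)
have : M * X * (1 / 4) <= q%:R * X.
  have : M * Z <= M * (5 / 4 * X) by apply: ler_wpM2l => //; lra.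
  lra.
by rewrite -mulrAC ler_pM2r // mul1r.
Qed.

Theorem theorem4 :
  exists c : RR, 0 < c /\
  exists s0 : nat,
  forall s : nat, (s0 <= s)%N ->
  forall eps : RR, 1 / s%:R <= eps -> eps <= 1 / 9 ->
  exists N : nat, forall n : nat, (N <= n)%N -> (s <= n)%N ->
  forall (d : measure_display) (Omega : measurableType d)
         (P : probability Omega RR) (A : algo Omega n) (q : nat),
  @convexity_tester d Omega P n s eps A q ->
  c * ln (eps * s%:R) / eps <= q%:R.
Proof.
(* The 1/64 is the 1/4 of the query bound times the 1/16 from [2^J > 1/(16 eps)]. *)
exists (1 / 64); split; first by lra.
exists 4%N => s s4 eps eps_s eps9.
have s0 : 0 < s%:R :> RR by rewrite ltr0n; lia.
have eps0 : 0 < eps by apply: lt_le_trans eps_s; rewrite divr_gt0.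
have eps_inv : 1 <= 1 / (8 * eps) by rewrite ler_pdivlMr; lra.
(* [J] is maximal with [8 eps 2^J <= 1], as farness requires, and [T] with [4 * 2^T <= s], as the
   number of derivatives requires. *)
pose J := trunc_log 2 (Num.trunc (1 / (8 * eps))).
pose T := trunc_log 2 (s %/ 4).
have /andP[J1 J2] : (2 ^ J)%:R * (8 * eps) <= 1 < (2 ^ J.+1)%:R * (8 * eps).
  have /andP[t1 t2] := truncn_itv (le_trans ler01 eps_inv).
  have t0 : (0 < Num.trunc (1 / (8 * eps)))%N.
    by rewrite -ltnS -(ltr_nat RR); apply: le_lt_trans t2.
  have /andP[e1 e2] := trunc_log_bounds (isT : (1 < 2)%N) t0.
  have e0 : 0 < 8 * eps by lra.
  apply/andP; split.
    by rewrite -ler_pdivlMr //; apply: le_trans t1; rewrite ler_nat.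
  by rewrite -ltr_pdivrMr //; apply: lt_le_trans t2 _; rewrite ler_nat.
have /andP[T1 T2] : (4 * 2 ^ T <= s < 8 * 2 ^ T)%N.
  have s40 : (0 < s %/ 4)%N by rewrite divn_gt0.
  have := trunc_log_bounds (isT : (1 < 2)%N) s40.
  by rewrite -/T /= expnS; lia.
clearbody J T.
have s8 : s%:R < 8 * (2 ^ T)%:R :> RR by rewrite -[8]/(8%:R) -natrM ltr_nat.
have eps_s1 : 1 <= eps * s%:R by move: eps_s; rewrite ler_pdivrMr.
have JT : (J <= T)%N.
  rewrite -(@leq_exp2l 2) // -(ler_nat RR) -(ler_pM2r eps0).
  by have := ler_wpM2l (ltW eps0) (ltW s8); lra.
have ET : (J + (T - J) = T)%N by rewrite subnKC.
(* This makes [r = n %/ 2^(T+1)] at least [2^T]. *)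
exists (2 ^ T.+1 * 2 ^ T)%N => n Nn _ d Omega P A q tester.
have q_bound : (2 ^ J * (T - J))%:R / 4 <= q%:R :> RR.
  have p0 : (0 < 2 ^ T.+1)%N by rewrite expn_gt0.
  apply: (convexity_tester_queries J (T - J) (n %/ 2 ^ T.+1) _ _ _ _ _ tester).
  - by rewrite ET leq_divRL // mulnC.
  - by rewrite ET [X in (X <= _)%N]mulnC leq_trunc_div mulnC ltn_ceil.
  - have : (0 < 2 ^ T)%N by rewrite expn_gt0.
    by rewrite ET; move: (2 ^ T)%N T1 => k; lia.
  - exact: ltW.
  - by lra.
(* Here [eps s < 8 eps 2^J 2^(T-J) <= 2^(T-J)], and [ln 2 <= 1]. *)
have ln_L : ln (eps * s%:R) <= (T - J)%:R.
  have le2L : eps * s%:R <= 2 ^+ (T - J).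
    have : (2 ^ T)%:R = (2 ^ J)%:R * 2 ^+ (T - J) :> RR.
      by rewrite -{1}ET expnD natrM !natrX.
    have : 0 <= 2 ^+ (T - J) :> RR by rewrite exprn_ge0.
    nra.
  apply: (@le_trans _ _ (ln (2 ^+ (T - J)))); first by rewrite ler_ln ?posrE //; lra.
  by rewrite lnXn //; apply: ler_wMn2r; apply: le_ln1Dx; lra.
rewrite ler_pdivrMr //; apply: le_trans (ler_wpM2r (ltW eps0) q_bound).
rewrite natrM; move: J2; rewrite expnS natrM.
have := ler0n RR (T - J); nra.
Qed.
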